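(* Let $n\ge 2$, let $[n]=D\sqcup U$ be a partition as in the context, and let $P\subset\mathbb R^n$ be a polytope with the same normal fan as $\mathsf{As}_{n-1}^{D,U}$, with tight right-hand sides $z_J$ and Minkowski coefficients $y_J$ ($J\subseteq[n]$) as defined in the context. Let $I$ be a non-empty subset of $[n]$ with $v$ nested components. Then $$y_I=\begin{cases}(-1)^{|I\setminus R_{\delta_1}|}\left(z_{R_{\delta_1}}-z_{R_{\delta_2}}-z_{R_{\delta_3}}+z_{R_{\delta_4}}\right) & \text{if } v=1,\\ 0 & \text{otherwise,}\end{cases}$$ where, for $v=1$, $\delta_1,\delta_2,\delta_3,\delta_4$ are the four diagonals associated to $I$ defined in the context.
   Context: Partition and polygon. $[n]=\{1,\dots,n\}=D\sqcup U$ with $D=\{d_1=1<d_2<\dots<d_\ell=n\}$ ($\ell\ge2$) and $U=\{u_1<\dots<u_m\}$ ($m\ge0$). Put $\overline D=D\cup\{0,n+1\}$. $Q$ is a convex $(n+2)$-gon whose vertices are labelled, in counter-clockwise cyclic order, $0,d_1,\dots,d_\ell,n+1,u_m,\dots,u_1$. A diagonal is a pair $\{x,y\}$ of labels, $x\le y$ (possibly $x=y$); it is proper if $x\ne y$ and $x,y$ are not adjacent on the boundary of $Q$. Sets $R_\delta$. For $\delta=\{x,y\}$, $x\le y$: $R_\delta=\{d\in D: x<d<y\}$ if $x,y\in\overline D$; $R_\delta=\{d\in D:d>x\}\cup\{u\in U:u\ge y\}$ if $x\in\overline D,\ y\in U$; $R_\delta=\{d\in D:d<y\}\cup\{u\in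 U:u\le x\}$ if $x\in U,\ y\in\overline D$; $R_\delta=D\cup\{u\in U:u\le x\}\cup\{u\in U:u\ge y\}$ if $x,y\in U$. (For non-proper $\delta$ this gives $\varnothing$ if $x,y\in\overline D$, except $R_{\{0,n+1\}}=[n]$ when $U=\varnothing$, and $[n]$ otherwise.) Nested components. For non-empty $I\subseteq[n]$ write $\overline D\setminus I=\{e_0=0<e_1<\dots<e_k=n+1\}$. The nested components of $I$ are the non-empty sets among $I\cap(e_{i-1},e_i)$, $1\le i\le k$; $v$ is their number. Four diagonals. If $v=1$, let $a<b$ be the consecutive elements of $\overline D\setminus I$ with $I\subseteq(a,b)$, and let $\gamma=\min I$, $\Gamma=\max I$. Set $\delta_1=\{a,b\}$, $\delta_2=\{a,\Gamma\}$, $\delta_3=\{\gamma,b\}$, $\delta_4=\{\gamma,\Gamma\}$. Polytopes. $\mathsf{As}_{n-1}^{D,U}$ is the $(n-1)$-dimensional associahedron $\{x\in\mathbb R^n:\sum_{i\in[n]}x_i=\tfrac{n(n+1)}2,\ \sum_{i\in R_\delta}x_i\ge\tfrac{|R_\delta|(|R_\delta|+1)}2\text{ for all proper diagonals }\delta\}$. For a polytope $P\subset\mathbb R^n$ with the same normal fan, the tight right-hand sides are $z_J=\min_{x\in P}\sum_{i\in J}x_i$ for $\varnothing\ne J\subseteq[n]$ and $z_\varnothing=0$, and its Minkowski coefficients are $y_I=\sum_{J\subseteq I}(-1)^{|I\setminus J|}z_J$ (equivalently, the unique coefficients of the decomposition of $P$ as Minkowski sum and difference $\sum_I y_I\Delta_I$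 of the simplices $\Delta_I=\operatorname{conv}\{e_i: i\in I\}$, $\varnothing\neq I\subseteq[n]$). *)

(* Defs.v *)
From HB Require Import structures.
From mathcomp Require Import all_boot all_order all_algebra.
From mathcomp Require Import all_classical all_reals.
From mathcomp Require Import finset.

Set Implicit Arguments.
Unset Strict Implicit.
Unset Printing Implicit Defensive.

Import Order.TTheory GRing.Theory Num.Theory.

(* The set [n] = {1, ..., n} is represented by 'I_n, where i : 'I_n stands for
   the number i.+1; the labels 0, ..., n+1 of the polygon are 'I_n.+2. *)
Section Combinatorics.
Variable n : nat.
Implicit Types (D U I : {set 'I_n}) (x y : 'I_n.+2) (d : 'I_n.+2 * 'I_n.+2).

Definition label (i : 'I_n) : 'I_n.+2 := @Ordinal n.+2 i.+1 (ltnW (ltn_ord i)).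

Definition labels I : {set 'I_n.+2} := [set label i | i in I].

Definition updown_partition D U : Prop :=
  [/\ D :|: U = setT, [disjoint D & U],
      inord 1 \in labels D & inord n \in labels D].

Definition Dbar D : {set 'I_n.+2} := labels D :|: [set ord0; ord_max].

(* The cyclic sequence 0, d_1, ..., d_l, n+1, u_m, ..., u_1 (enum is
   increasing on ordinals). *)
Definition boundary D U : seq 'I_n.+2 :=
  ord0 :: enum (labels D) ++ ord_max :: rev (enum (labels U)).

Definition adjacent D U x y : bool :=
  (next (boundary D U) x == y) || (next (boundary D U) y == x).

(* A diagonal {x, y} with x <= y is represented by the ordered pair (x, y). *)
Definition proper_diagonal D U d : bool :=
  (d.1 < d.2) && ~~ adjacent D U d.1 d.2.

(* U is the complement of D, so a label outside Dbar D is a label of U. *)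
Definition Rset D U d : {set 'I_n} :=
  match d.1 \in Dbar D, d.2 \in Dbar D with
  | true, true => [set i in D | d.1 < label i < d.2]
  | true, false => [set i in D | d.1 < label i] :|: [set i in U | d.2 <= label i]
  | false, true => [set i in D | label i < d.2] :|: [set i in U | label i <= d.1]
  | false, false =>
      D :|: [set i in U | label i <= d.1] :|: [set i in U | d.2 <= label i]
  end.

Definition open_interval d : {set 'I_n} := [set i | d.1 < label i < d.2].

(* The pairs (e_{i-1}, e_i) of consecutive elements of Dbar D \ I. *)
Definition gaps D I : seq ('I_n.+2 * 'I_n.+2) :=
  let e := enum (Dbar D :\: labels I) in zip e (behead e).

Definition nested_components D I : {set {set 'I_n}} :=
  [set I :&: open_interval d | d in gaps D I] :\ set0.

(* The pair (a, b); the default value is never used when I has exactly one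
   nested component, see enclosing_gapP below. *)
Definition enclosing_gap D I : 'I_n.+2 * 'I_n.+2 :=
  head (ord0, ord_max) [seq d <- gaps D I | I \subset open_interval d].

(* The labels of min I and max I, for non-empty I. *)
Definition min_label I : 'I_n.+2 := head ord0 (enum (labels I)).
Definition max_label I : 'I_n.+2 := last ord0 (enum (labels I)).

Definition delta1 D I := enclosing_gap D I.
Definition delta2 D I := ((enclosing_gap D I).1, max_label I).
Definition delta3 D I := (min_label I, (enclosing_gap D I).2).
Definition delta4 I := (min_label I, max_label I).

Let consecutive_between (i : nat) x s : x < i < last x s ->
  {in x :: s, forall y, y != i :> nat} ->
  exists2 d, d \in zip (x :: s) s & d.1 < i < d.2.
Proof.
elim: s x => [|y s IHs] x /=; first by case/andP=> /ltn_trans h /h; rewrite ltnn.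
case/andP=> ltxi lti neq; have [ltiy|leyi] := ltnP i y.
  by exists (x, y); rewrite ?mem_head //= ltxi.
have ltyi : y < i.
  by rewrite ltn_neqAle leyi andbT neq // inE mem_head orbT.
have [|z zs|d din dP] := IHs y; first by rewrite ltyi.
  by apply: neq; rewrite inE zs orbT.
by exists d; rewrite // inE din orbT.
Qed.

Lemma gap_cover D I i : i \in I ->
  exists2 d, d \in gaps D I & i \in open_interval d.
Proof.
move=> iI; rewrite /gaps; set A := _ :\: _.
have notI x : (x == ord0) || (x == ord_max) -> x \in A.
  move=> xE; rewrite !inE xE orbT andbT; apply/imsetP=> -[j _ xj].
  move: xE; rewrite xj -!val_eqE /= eqSS => /eqP jn.
  by have := ltn_ord j; rewrite jn ltnn.
have filterE : enum A = [seq x <- enum 'I_n.+2 | x \in A].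
  by rewrite enumT.
have lastE : last ord0 (enum A) = ord_max.
  by rewrite filterE enum_ordSr filter_rcons notI ?eqxx ?orbT // last_rcons.
have [s sE] : exists s, enum A = ord0 :: s.
  by rewrite filterE enum_ordSl /= notI ?eqxx //; eexists.
rewrite sE /= in lastE *; have [||d din dP] := @consecutive_between i.+1 ord0 s.
- by rewrite lastE /= ltnS ltn_ord.
- move=> y; rewrite -sE mem_enum !inE => /andP[yI _]; apply: contra yI => /eqP yi.
  by apply/imsetP; exists i => //; apply: val_inj.
by exists d; rewrite // inE.
Qed.

Lemma enclosing_gapP D I : #|nested_components D I| = 1 ->
  enclosing_gap D I \in gaps D I /\ I \subset open_interval (enclosing_gap D I).
Proof.
move=> /eqP/cards1P[C compE].
have : C \in nested_components D I by rewrite compE inE.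
rewrite in_setD1 => /andP[_ /imsetP[d din CE]].
have Id : I \subset open_interval d.
  apply/fintype.subsetP => i iI; have [d' d'in id'] := gap_cover D iI.
  have : I :&: open_interval d' \in nested_components D I.
    rewrite in_setD1; apply/andP; split; last by apply/imsetP; exists d'.
    by apply/set0Pn; exists i; rewrite inE iI.
  rewrite compE inE => /eqP E.
  have : i \in I :&: open_interval d' by rewrite inE iI.
  by rewrite E CE inE iI.
have : has (fun d => I \subset open_interval d) (gaps D I) by apply/hasP; exists d.
rewrite has_filter /enclosing_gap.
case E: [seq _ <- _ | _] => [//|e s] _ /=.
have : e \in e :: s by rewrite mem_head.
by rewrite -E mem_filter => /andP[].
Qed.

End Combinatorics.

Local Open Scope ring_scope.

Section Polytopes.
Variables (R : realType) (n : nat).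
Implicit Types (P F : set 'rV[R]_n) (c x : 'rV[R]_n) (J : {set 'I_n}).

Definition dot c x : R := \sum_i c ord0 i * x ord0 i.

Definition sum_on J x : R := \sum_(i in J) x ord0 i.

Definition conv_hull k (v : 'I_k -> 'rV[R]_n) : set 'rV[R]_n :=
  [set x | exists w : 'I_k -> R,
     [/\ forall i, 0 <= w i, \sum_i w i = 1 & x = \sum_i w i *: v i]]%classic.

Definition polytope P : Prop :=
  exists (k : nat) (v : 'I_k.+1 -> 'rV[R]_n), P = conv_hull v.

Definition face P c : set 'rV[R]_n :=
  [set x | P x /\ forall y, P y -> dot c y <= dot c x]%classic.

Definition nonempty_faces P : set (set 'rV[R]_n) :=
  [set F | (exists x, F x) /\ exists c, F = face P c]%classic.

Definition normal_cone P F : set 'rV[R]_n :=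
  [set c | forall x y, F x -> P y -> dot c y <= dot c x]%classic.

Definition normal_fan P : set (set 'rV[R]_n) :=
  [set normal_cone P F | F in nonempty_faces P]%classic.

Definition associahedron (D U : {set 'I_n}) : set 'rV[R]_n :=
  [set x | sum_on setT x = (n * n.+1)%:R / 2 /\
     forall d, proper_diagonal D U d ->
       (#|Rset D U d| * #|Rset D U d|.+1)%:R / 2 <= sum_on (Rset D U d) x]%classic.

(* On a polytope the infimum is a minimum, see tight_rhsP below; the value at
   the empty set is 0, see tight_rhs0. *)
Definition tight_rhs P J : R := inf [set sum_on J x | x in P]%classic.

Definition minkowski_coeff P (I : {set 'I_n}) : R :=
  \sum_(J : {set 'I_n} | J \subset I) (-1) ^+ #|I :\: J| * tight_rhs P J.

Lemma tight_rhsP P J : polytope P ->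
  (exists2 x, P x & tight_rhs P J = sum_on J x) /\
  (forall x, P x -> tight_rhs P J <= sum_on J x).
Proof.
case=> k [v ->].
have vP j : conv_hull v (v j).
  exists (fun i => (i == j)%:R); split=> [i||]; first exact: ler0n.
    by rewrite (bigD1 j) //= eqxx big1 ?addr0 // => i /negbTE ->.
  rewrite (bigD1 j) //= eqxx scale1r big1 ?addr0 // => i /negbTE ->.
  by rewrite scale0r.
have [j0 _ j0min] := @arg_minP _ _ _ ord0 xpredT (fun j => sum_on J (v j)) isT.
have lb x : conv_hull v x -> sum_on J (v j0) <= sum_on J x.
  case=> w [w0 w1 ->].
  have -> : sum_on J (\sum_i w i *: v i) = \sum_i w i * sum_on J (v i).
    rewrite /sum_on; under eq_bigr do rewrite summxE.
    rewrite exchange_big; apply: eq_bigr => i _; rewrite mulr_sumr.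
    by apply: eq_bigr => l _; rewrite mxE.
  rewrite -[X in X <= _]mul1r -w1 mulr_suml; apply: ler_sum => i _.
  by apply: ler_wpM2l => //; exact: j0min.
have E : tight_rhs (conv_hull v) J = sum_on J (v j0).
  apply/eqP; rewrite eq_le; apply/andP; split.
    apply: ge_inf; last by exists (v j0).
    by exists (sum_on J (v j0)) => _ [x xP <-]; exact: lb.
  apply: lb_le_inf; first by exists (sum_on J (v j0)); exists (v j0).
  by move=> _ [x xP <-]; exact: lb.
by rewrite E; split; [exists (v j0) | exact: lb].
Qed.

Lemma tight_rhs0 P : polytope P -> tight_rhs P set0 = 0.
Proof.
by move=> /(tight_rhsP set0)[[x _ ->] _]; rewrite /sum_on big_set0.
Qed.

End Polytopes.

(* Main.v *)
Require Import Defs.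
From HB Require Import structures.
From mathcomp Require Import all_boot all_order all_algebra.
From mathcomp Require Import all_classical all_reals.
From mathcomp Require Import finset.
From mathcomp Require Import zify ring lra.
Import Order.TTheory GRing.Theory Num.Theory.
Local Open Scope ring_scope.

(* Let W(J) be the symmetric difference of Dbar D and J. Listing its elements
   increasingly from 0 to n+1 gives a path, and the indicator of J is the sum of
   the indicators of R_{p,q} over the consecutive pairs (p,q) of that path, minus
   |J \ D| times the indicator of [n]. All these R_{p,q} are simultaneously tight
   on some point of the associahedron; the equality of normal fans transfers this
   to P, so that z_J is given by the same path formula in the z_{R_{p,q}}.
   A mixed second difference of the path formula at i < j vanishes if a vertex of
   the path lies between i and j, and otherwise equals, up to sign,
   z_{ij} - z_{iq} - z_{pj} + z_{pq}, where p and q are the neighbours of i and j.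
   Taken at min I and max I, it leaves a single summand of y_I, the one of
   J = D \cap (min I, max I), which occurs exactly when I has one component.
   The tight point comes from the greedy algorithm: for the right-hand sides
   h(k) = k(k+1)/2 of the associahedron the path formula is supermodular, because
   |R_{p,q}| = A(p) + B(q) turns the second difference into
   (A(i) - A(p)) (B(j) - B(q)). *)

Set Implicit Arguments.
Unset Strict Implicit.
Unset Printing Implicit Defensive.

(** * The greedy algorithm for supermodular set functions *)

Section Greedy.
Variables (T : finType) (R : realDomainType) (f : {set T} -> R).
Implicit Types (A B K S : {set T}) (x : T -> R).

Hypothesis f0 : f set0 = 0.
Hypothesis f_supermodular : forall A i j, i \notin A -> j \notin A -> i != j ->
  f (i |: A) + f (j |: A) <= f (i |: (j |: A)) + f A.

(** Supermodularity at pairs suffices: elements of B \ A are removed from B one at a time, with the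
    hypothesis applied at each removal. *)
Lemma marginal_homo A B i : A \subset B -> i \notin B ->
  f (i |: A) - f A <= f (i |: B) - f B.
Proof.
have [k] := ubnP #|B|; elim: k B => // k IHB B ltBk subAB iNB.
have [/eqP <- //|neqAB] := boolP (A == B).
have /properP[_ [j jB jNA]] : A \proper B by rewrite properEneq neqAB.
have subABj : A \subset B :\ j by rewrite subsetD1 subAB.
have iNBj : i \notin B :\ j by rewrite !inE negb_and iNB orbT.
apply: le_trans (IHB (B :\ j) _ subABj iNBj) _.
  by rewrite (cardsD1 j B) jB in ltBk.
have neqij : i != j by apply: contraNneq iNB => ->.
have := @f_supermodular (B :\ j) i j iNBj; rewrite setD11 => /(_ isT neqij).
by rewrite setD1K //; lra.
Qed.

(** The core of the convex game obtained by restricting [f] to the subsets of [S]. *)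
Definition base_on S x :=
  \sum_(i in S) x i = f S /\ forall K, K \subset S -> f K <= \sum_(i in K) x i.

Lemma base_on_extend S S' x : S \subset S' -> base_on S x ->
  exists2 y, {in S, x =1 y} & base_on S' y.
Proof.
have [k] := ubnP #|S'|; elim: k S' => // k IH S' ltSk subSS' xS.
have [/eqP <-|neqSS'] := boolP (S == S'); first by exists x.
have /properP[_ [i iS' iNS]] : S \proper S' by rewrite properEneq neqSS'.
have subSi : S \subset S' :\ i by rewrite subsetD1 subSS'.
have [|y xy [yS yK]] := IH (S' :\ i) _ subSi xS.
  by rewrite (cardsD1 i S') iS' in ltSk.
(* Greedy choice: the new coordinate is the marginal value of [i] over [S' :\ i]. It dominates the
   marginal value of [i] over every smaller set, so no lower bound is violated. *)
pose z j := if j == i then f S' - f (S' :\ i) else y j.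
have zE K : i \notin K -> \sum_(j in K) z j = \sum_(j in K) y j.
  move=> iNK; apply: eq_bigr => j jK; rewrite /z ifN //.
  by apply: contraNneq iNK => <-.
exists z => [j jS|].
  by rewrite /z ifN ?xy //; apply: contraNneq iNS => <-.
split=> [|K subKS'].
  by rewrite (big_setD1 i) //= zE ?setD11 // yS /z eqxx subrK.
have [iK|iNK] := boolP (i \in K); last first.
  by rewrite zE // yK // subsetD1 subKS'.
rewrite (big_setD1 i) //= zE ?setD11 // /z eqxx.
have subKi : K :\ i \subset S' :\ i by apply: setSD.
have := marginal_homo subKi (negbT (setD11 i S')); rewrite !setD1K // => marg.
have := yK _ subKi; lra.
Qed.

(** Two greedy runs, first up to [S] and then up to the full set; the second keeps the coordinates
    in [S], hence the tightness there. *)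
Lemma supermodular_base S : exists x,
  [/\ \sum_(i in S) x i = f S, \sum_i x i = f setT &
      forall K, f K <= \sum_(i in K) x i].
Proof.
have base0 : base_on set0 (fun=> 0).
  by split=> [|K]; rewrite ?big_set0 // subset0 => /eqP ->; rewrite f0 big_set0.
have [x _ [xS xK]] := base_on_extend (sub0set S) base0.
have [y xy [yT yK]] := base_on_extend (subsetT S) (conj xS xK).
exists y; split=> [||K]; last by rewrite yK ?subsetT.
  by rewrite -xS; apply: eq_bigr => i /xy ->.
by rewrite -yT; apply: eq_bigl => i; rewrite inE.
Qed.

End Greedy.

(** * Consecutive pairs and path sums *)

Section Consecutive.
Variable m : nat.
Implicit Types (W : {set 'I_m}) (d : 'I_m * 'I_m) (p q i j : 'I_m).

Definition consecutive W : {set 'I_m * 'I_m} :=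
  [set d | [&& d.1 \in W, d.2 \in W, (d.1 < d.2)%N &
            [forall w in W, ~~ (d.1 < w < d.2)%N]]].

Lemma consecutiveP W p q : reflect
  [/\ p \in W, q \in W, (p < q)%N & forall w, w \in W -> (p < w < q)%N = false]
  ((p, q) \in consecutive W).
Proof.
rewrite inE /=; apply: (iffP and4P) => -[pW qW ltpq Wpq]; split=> //.
  by move=> w wW; apply: negbTE; move/forall_inP: Wpq; exact.
by apply/forall_inP => w wW; rewrite Wpq.
Qed.

Lemma consecutive_around W p0 q0 i : p0 \in W -> q0 \in W -> (p0 < i < q0)%N ->
  i \notin W -> exists p q, (p, q) \in consecutive W /\ (p < i < q)%N.
Proof.
move=> p0W q0W /andP[ltp0i ltiq0] iNW.
have [|p /andP[pW ltpi] pmax] :=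
    @arg_maxnP _ p0 [pred p | (p \in W) && (p < i)%N] (@nat_of_ord m).
  by rewrite /= p0W.
have [|q /andP[qW ltiq] qmin] :=
    @arg_minnP _ q0 [pred q | (q \in W) && (i < q)%N] (@nat_of_ord m).
  by rewrite /= q0W.
exists p, q; split; last by rewrite ltpi.
apply/consecutiveP; split=> //; first exact: ltn_trans ltiq.
move=> w wW; have [ltwi|ltiw|/val_inj wi] := ltngtP w i.
- by have := pmax w; rewrite /= wW ltwi => /(_ isT); lia.
- by have := qmin w; rewrite /= wW ltiw => /(_ isT); lia.
- by rewrite -wi wW in iNW.
Qed.

(** The two inequalities make the pairs overlap; if corresponding ends differed, one of them would
    lie strictly inside the other pair. *)
Lemma consecutive_overlap W p q p' q' :
  (p, q) \in consecutive W -> (p', q') \in consecutive W ->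
  (p < q')%N -> (p' < q)%N -> (p, q) = (p', q').
Proof.
move=> /consecutiveP[pW qW ltpq Wpq] /consecutiveP[p'W q'W ltpq' Wpq'] pq' p'q.
have := Wpq _ p'W; have := Wpq _ q'W; have := Wpq' _ pW; have := Wpq' _ qW.
by move=> *; congr pair; apply: val_inj => /=; lia.
Qed.

Lemma consecutive_setU1 W p q i : (p, q) \in consecutive W -> (p < i < q)%N ->
  consecutive (i |: W) = (p, i) |: ((i, q) |: consecutive W :\ (p, q)).
Proof.
move=> pqW /andP[ltpi ltiq]; have [pW qW ltpq Wpq] := consecutiveP _ _ _ pqW.
apply/setP=> -[x y]; rewrite !in_setU1 in_setD1 !xpair_eqE.
apply/consecutiveP/idP => [[]|].
  rewrite !in_setU1 => /orP[/eqP->|xW] /orP[/eqP->|yW] ltxy xy.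
  - by rewrite ltnn in ltxy.
  - suff -> : y = q by rewrite !eqxx orbT.
    have := Wpq _ yW; have := xy q; rewrite in_setU1 qW orbT => /(_ isT).
    by move=> *; apply: val_inj => /=; lia.
  - suff -> : x = p by rewrite !eqxx.
    have := Wpq _ xW; have := xy p; rewrite in_setU1 pW orbT => /(_ isT).
    by move=> *; apply: val_inj => /=; lia.
  - apply/orP; right; apply/orP; right; apply/andP; split.
      apply/negP=> /andP[/eqP xp /eqP yq].
      by have := xy i; rewrite setU11 xp yq ltpi ltiq => /(_ isT).
    by apply/consecutiveP; split=> // w wW; apply: xy; rewrite in_setU1 wW orbT.
case/or3P=> [/andP[/eqP-> /eqP->]|/andP[/eqP-> /eqP->]|/andP[neq]].
- split; rewrite ?setU11 ?in_setU1 ?pW ?orbT // => w /setU1P[->|/Wpq].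
    by rewrite ltnn andbF.
  by move=> ?; lia.
- split; rewrite ?setU11 ?in_setU1 ?qW ?orbT // => w /setU1P[->|/Wpq].
    by rewrite ltnn.
  by move=> ?; lia.
move=> xyW; case/consecutiveP: (xyW) => xW yW ltxy Wxy.
split; rewrite ?in_setU1 ?xW ?yW ?orbT // => w /setU1P[->|wW]; last exact: Wxy.
apply: contraNF neq => /andP[ltxi ltiy].
have [-> ->] : (x, y) = (p, q); last by rewrite !eqxx.
by apply: (consecutive_overlap xyW pqW); [exact: ltn_trans ltiq | exact: ltn_trans ltiy].
Qed.

Variables (V : comNzRingType) (G : 'I_m * 'I_m -> V).

Definition path_sum W : V := \sum_(d in consecutive W) G d.

Lemma path_sum_setU1 W p q i : (p, q) \in consecutive W -> (p < i < q)%N ->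
  path_sum (i |: W) = path_sum W + (G (p, i) + G (i, q) - G (p, q)).
Proof.
move=> pqW pqi; have [pW qW ltpq Wpq] := consecutiveP _ _ _ pqW.
have iNW : i \notin W by apply/negP => /Wpq; rewrite pqi.
have notin y z : i \in [:: y; z] -> (y, z) \notin consecutive W.
  rewrite !in_cons in_nil orbF => yzi; apply/negP => /consecutiveP[yW zW _ _].
  by move: iNW; case/orP: yzi => /eqP ->; rewrite ?yW ?zW.
rewrite /path_sum (consecutive_setU1 pqW pqi) big_setU1 ?big_setU1 //=.
- by rewrite [in RHS](big_setD1 (p, q)) //=; ring.
- by rewrite in_setD1 negb_and notin ?orbT // mem_head.
rewrite in_setU1 in_setD1 negb_or negb_and notin ?orbT ?andbT.
  by apply/eqP => -[_ iq]; rewrite iq ltnn andbF in pqi.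
by rewrite !inE eqxx orbT.
Qed.

Definition path_diff2 W i j :=
  path_sum (i |: (j |: W)) - path_sum (i |: W) - path_sum (j |: W) + path_sum W.

(** Inserting [j] splits (i, q) if [i] is present and (p, q) otherwise; the term [G (j, q)] arises
    in both cases and cancels. *)
Lemma path_diff2_consecutive W p q i j : (p, q) \in consecutive W ->
  (p < i)%N -> (i < j)%N -> (j < q)%N ->
  path_diff2 W i j = G (i, j) - G (i, q) - G (p, j) + G (p, q).
Proof.
move=> pqW ltpi ltij ltjq.
have pqi : (p < i < q)%N by lia.
have pqj : (p < j < q)%N by lia.
have iqW : (i, q) \in consecutive (i |: W).
  by rewrite (consecutive_setU1 pqW pqi) !in_setU1 eqxx orbT.
rewrite /path_diff2 setUCA (path_sum_setU1 iqW) ?ltij //.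
by rewrite (path_sum_setU1 pqW pqi) (path_sum_setU1 pqW pqj); ring.
Qed.

(** Because of [w], the pair split by [j] is not affected by inserting [i], so the increment due to
    [j] is the same with and without [i]. The vertices [w0] and [w1] guarantee outer neighbours. *)
Lemma path_diff2_separated W i j w0 w1 w : w0 \in W -> w1 \in W -> w \in W ->
  i \notin W -> j \notin W -> (w0 < i)%N -> (i < w < j)%N -> (j < w1)%N ->
  path_diff2 W i j = 0.
Proof.
move=> w0W w1W wW iNW jNW ltwi iwj ltjw.
have [|p [q [pqW pqi]]] := consecutive_around w0W w1W _ iNW; first by lia.
have [|p' [q' [pqW' pqj]]] := consecutive_around w0W w1W _ jNW; first by lia.
have pqW'' : (p', q') \in consecutive (i |: W).
  rewrite (consecutive_setU1 pqW pqi) !in_setU1 in_setD1 pqW' andbT.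
  rewrite [X in _ || (_ || X)](_ : _ = true) ?orbT //.
  have [_ _ _ /(_ _ wW) h] := consecutiveP _ _ _ pqW.
  have [_ _ _ /(_ _ wW) h'] := consecutiveP _ _ _ pqW'.
  by apply/eqP=> -[pp qq]; subst; lia.
rewrite /path_diff2 setUCA (path_sum_setU1 pqW'' pqj) (path_sum_setU1 pqW' pqj).
by ring.
Qed.

End Consecutive.

(** * Labels and the path attached to a subset *)

Section Labels.
Variable n : nat.
Implicit Types (D I J : {set 'I_n}) (p q : 'I_n.+2) (i j : 'I_n).

Lemma label_inj : injective (@label n).
Proof. by move=> i j /(congr1 val) /= [] ij; apply: val_inj. Qed.

Lemma mem_labels J i : (label i \in labels J) = (i \in J).
Proof. by rewrite mem_imset //; exact: label_inj. Qed.

Lemma label_neq0 i : (label i == ord0) = false.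
Proof. by apply/eqP => /(congr1 val). Qed.

Lemma label_neq_max i : (label i == ord_max) = false.
Proof. by apply/eqP => /(congr1 val) /= []; have := ltn_ord i; lia. Qed.

Lemma label_gt0 i : (@ord0 n.+1 < label i)%N.
Proof. by []. Qed.

Lemma label_lt_max i : (label i < @ord_max n.+1)%N.
Proof. by have := ltn_ord i; rewrite /=; lia. Qed.

Lemma ord0_notin_labels J : (ord0 \in labels J) = false.
Proof. by apply/imsetP => -[i _ /esym/eqP]; rewrite label_neq0. Qed.

Lemma ord_max_notin_labels J : (ord_max \in labels J) = false.
Proof. by apply/imsetP => -[i _ /esym/eqP]; rewrite label_neq_max. Qed.

Variant label_spec p : Type :=
  | LabelOrd0 of p = ord0
  | LabelOrdMax of p = ord_max
  | LabelOf i of p = label i.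

Lemma labelP p : label_spec p.
Proof.
have [p0|pn0] := eqVneq p ord0; first exact: LabelOrd0.
have [pm|pnm] := eqVneq p ord_max; first exact: LabelOrdMax.
have p_gt0 : (0 < p)%N by rewrite lt0n; apply: contra pn0 => /eqP p0; apply/eqP; apply: val_inj.
have p_le : (p.-1 < n)%N.
  have : (p != n.+1 :> nat) by apply: contra pnm => /eqP pE; apply/eqP; apply: val_inj.
  by have := ltn_ord p; lia.
by apply: (@LabelOf p (Ordinal p_le)); apply: val_inj => /=; rewrite prednK.
Qed.

Lemma mem_Dbar D i : (label i \in Dbar D) = (i \in D).
Proof. by rewrite in_setU mem_labels !inE label_neq0 label_neq_max !orbF. Qed.

Lemma ord0_Dbar D : ord0 \in Dbar D.
Proof. by rewrite in_setU in_set2 eqxx orbT. Qed.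

Lemma ord_max_Dbar D : ord_max \in Dbar D.
Proof. by rewrite in_setU in_set2 eqxx !orbT. Qed.

(* Inside J the elements of D are removed from Dbar D and those of U added. *)
Definition path_set D J : {set 'I_n.+2} :=
  [set p | (p \in Dbar D) (+) (p \in labels J)].

Lemma path_set_label D J i : (label i \in path_set D J) = (i \in D) (+) (i \in J).
Proof. by rewrite inE mem_Dbar mem_labels. Qed.

Lemma path_set_ord0 D J : ord0 \in path_set D J.
Proof. by rewrite inE ord0_Dbar ord0_notin_labels. Qed.

Lemma path_set_ord_max D J : ord_max \in path_set D J.
Proof. by rewrite inE ord_max_Dbar ord_max_notin_labels. Qed.

Lemma path_set0 D : path_set D set0 = Dbar D.
Proof.
by apply/setP=> p; rewrite inE /labels imset0 in_set0 addbF.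
Qed.

Definition has_ends (W : {set 'I_n.+2}) := (ord0 \in W) && (ord_max \in W).

Lemma has_endsD1 W i : has_ends W -> has_ends (W :\ label i).
Proof.
by rewrite /has_ends !in_setD1 !(eq_sym _ (label i)) label_neq0 label_neq_max.
Qed.

Lemma path_set_ends D J : has_ends (path_set D J).
Proof. by rewrite /has_ends path_set_ord0 path_set_ord_max. Qed.

Lemma consecutive_around_label W i : has_ends W -> label i \notin W ->
  exists p q, (p, q) \in consecutive W /\ (p < label i < q)%N.
Proof.
move=> /andP[W0 Wm]; apply: consecutive_around W0 Wm _.
by rewrite label_gt0 label_lt_max.
Qed.

(** Insertion controlled by a boolean treats all terms of a difference at once: adding i to J
    inserts [label i] into the path if i is in U and deletes it if i is in D, which is an exclusive
    or. *)
Definition add_if (T : finType) (b : bool) (x : T) (A : {set T}) :=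
  if b then x |: A else A.

Lemma in_add_if (T : finType) b (x y : T) A :
  (y \in add_if b x A) = b && (y == x) || (y \in A).
Proof. by rewrite /add_if; case: b; rewrite ?in_setU1. Qed.

Lemma path_set_add_if D J i j b c : i \notin J -> j \notin J -> i != j ->
  path_set D (add_if b i (add_if c j J)) =
  add_if (b (+) (i \in D)) (label i) (add_if (c (+) (j \in D)) (label j)
    (path_set D J :\ label i :\ label j)).
Proof.
move=> iNJ jNJ neqij; apply/setP=> p; rewrite !in_add_if !in_setD1.
case: (labelP p) => [-> | -> | k ->].
- by rewrite !path_set_ord0 !(eq_sym ord0) !label_neq0 !andbF.
- by rewrite !path_set_ord_max !(eq_sym ord_max) !label_neq_max !andbF.
rewrite !path_set_label !in_add_if !(inj_eq label_inj).
have [->|neqki] := eqVneq k i.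
  by rewrite (negbTE neqij) (negbTE iNJ) !(andbF, orbF, andbT) addbC.
have [->|neqkj] := eqVneq k j.
  by rewrite (negbTE jNJ) !(andbF, orbF, andbT) addbC.
by rewrite !andbF.
Qed.

Lemma path_set_add_if1 D J i b : i \notin J ->
  path_set D (add_if b i J) =
  add_if (b (+) (i \in D)) (label i) (path_set D J :\ label i).
Proof.
move=> iNJ; apply/setP=> p; rewrite !in_add_if !in_setD1.
case: (labelP p) => [-> | -> | k ->].
- by rewrite !path_set_ord0 !(eq_sym ord0) !label_neq0 !andbF.
- by rewrite !path_set_ord_max !(eq_sym ord_max) !label_neq_max !andbF.
rewrite !path_set_label !in_add_if !(inj_eq label_inj).
have [->|neqki] := eqVneq k i.
  by rewrite (negbTE iNJ) !(andbF, orbF, andbT) addbC.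
by rewrite !andbF.
Qed.

Lemma card_setU1_diff D J i : i \notin J ->
  #|(i |: J) :\: D| = ((i \notin D) + #|J :\: D|)%N.
Proof.
move=> iNJ; have [iD|iND] := boolP (i \in D).
  congr #|pred_of_set _|; apply/setP=> k; rewrite !inE.
  by have [->|] := eqVneq k i; rewrite ?iD.
have -> : (i |: J) :\: D = i |: (J :\: D).
  apply/setP=> k; rewrite !inE.
  by have [->|] := eqVneq k i; rewrite ?iND.
by rewrite cardsU1 !inE (negbTE iNJ) andbF.
Qed.

Section PathValue.
Variables (R : comNzRingType) (D : {set 'I_n}).

Definition path_value (G : 'I_n.+2 * 'I_n.+2 -> R) (c : R) J : R :=
  path_sum G (path_set D J) - c *+ #|J :\: D|.

(** Each of i, j that lies in D leaves the path when it enters J, which reverses one sign. The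
    correction by [c] is additive in J and drops out of a second difference. *)
Lemma path_value_diff2 G c J i j : i \notin J -> j \notin J -> i != j ->
  path_value G c (i |: (j |: J)) - path_value G c (i |: J)
    - path_value G c (j |: J) + path_value G c J =
  (-1) ^+ ((i \in D) + (j \in D)) *
    path_diff2 G (path_set D J :\ label i :\ label j) (label i) (label j).
Proof.
move=> iNJ jNJ neqij; set W := _ :\ _.
have E := fun b c => path_set_add_if D b c iNJ jNJ neqij.
have := (E true true, E true false, E false true, E false false).
rewrite /= -/W => {}E.
rewrite /path_value !E !card_setU1_diff ?in_setU1 ?negb_or ?neqij //.
rewrite /path_diff2 /add_if.
by case: (i \in D); case: (j \in D); rewrite /= !mulrnDr; ring.
Qed.

End PathValue.

(** * Splitting the indicator of R_{p,q} between its two ends *)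

Section Weights.
Variables (R : realDomainType) (D : {set 'I_n}).

(** For p < q no condition in R_{p,q} couples the ends: if both lie in [Dbar D], for instance,
    R_{p,q} is {d > p} minus {d >= q}. The contributions of p and of q are recorded separately, the
    latter with a sign. *)
Definition left_coeff p i : R :=
  if p \in Dbar D then ((i \in D) && (p < label i)%N)%:R
  else ((i \in D) || (label i <= p)%N)%:R.

Definition right_coeff q i : R :=
  if q \in Dbar D then - ((i \in D) && (q <= label i)%N)%:R
  else ((i \notin D) && (q <= label i)%N)%:R.

Lemma Rset_coeff p q i : (p < q)%N ->
  (i \in Rset D (~: D) (p, q))%:R = left_coeff p i + right_coeff q i.
Proof.
move=> ltpq; rewrite /Rset /left_coeff /right_coeff /=.
case: (p \in Dbar D); case: (q \in Dbar D);
  rewrite !inE; case: (i \in D) => /=;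
  rewrite ?(orbF, orFb, add0r, addr0, oppr0) //.
all: case: leqP => h1; try case: leqP => h2; rewrite /= ?subrr ?subr0 ?addr0 ?add0r //; lia.
Qed.

Lemma sum_Rset (w : 'I_n -> R) p q : (p < q)%N ->
  \sum_(i in Rset D (~: D) (p, q)) w i =
  \sum_i left_coeff p i * w i + \sum_i right_coeff q i * w i.
Proof.
move=> ltpq; rewrite -big_split big_mkcond /=; apply: eq_bigr => i _.
by rewrite -mulrDl -Rset_coeff //; case: (i \in _); rewrite ?mul1r ?mul0r.
Qed.

(** Inserting [label i] between p and q changes the sum of indicators by R_{p,i} + R_{i,q} -
    R_{p,q}. The parts of p and q cancel, and what remains is this sum: minus e_i for i in D, and
    [n] plus e_i for i in U. *)
Lemma left_right_coeff i k : left_coeff (label i) k + right_coeff (label i) k =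
  (i \notin D)%:R + (if i \in D then -1 else 1) * (k == i)%:R.
Proof.
rewrite /left_coeff /right_coeff mem_Dbar /=.
have [<-|neqki] := eqVneq k i.
  by case: (k \in D); rewrite /= ?ltnn ?leqnn /=; ring.
have : (k : nat) != i by [].
case: (i \in D); case: (k \in D) => /=; rewrite ?ltnS; case: ltngtP => //= *; ring.
Qed.

(** This and the next three comparisons give, coefficientwise, the signs of A(i) - A(p) and B(j) -
    B(q): nonpositive at an element of D, nonnegative at one of U. *)
Lemma left_coeff_le p i k : i \in D -> (p < label i)%N ->
  left_coeff (label i) k <= left_coeff p k.
Proof.
move=> iD ltpi; rewrite /left_coeff mem_Dbar iD.
by move: ltpi; case: ifP => _; case: (k \in D); rewrite /= ?ler_nat; lia.
Qed.

Lemma left_coeff_ge p i k : i \notin D -> (p < label i)%N ->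
  left_coeff p k <= left_coeff (label i) k.
Proof.
move=> iD ltpi; rewrite /left_coeff mem_Dbar (negbTE iD).
by move: ltpi; case: ifP => _; case: (k \in D); rewrite /= ?ler_nat; lia.
Qed.

Lemma right_coeff_le q j k : j \in D -> (label j < q)%N ->
  right_coeff (label j) k <= right_coeff q k.
Proof.
move=> jD ltjq; rewrite /right_coeff mem_Dbar jD.
move: ltjq; case: ifP => _; case: (k \in D);
  rewrite /= ?lerN2 ?oppr0 ?ler_nat ?oppr_le0 ?oppr_ge0 ?ler0n //; try lia.
Qed.

Lemma right_coeff_ge q j k : j \notin D -> (label j < q)%N ->
  right_coeff q k <= right_coeff (label j) k.
Proof.
move=> jD ltjq; rewrite /right_coeff mem_Dbar (negbTE jD).
move: ltjq; case: ifP => _; case: (k \in D);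
  rewrite /= ?lerN2 ?oppr0 ?ler_nat ?oppr_le0 ?oppr_ge0 ?ler0n //; try lia.
Qed.

Lemma sum_path_value (w : 'I_n -> R) J :
  \sum_(i in J) w i =
  path_value D (fun d => \sum_(i in Rset D (~: D) d) w i) (\sum_i w i) J.
Proof.
have [k] := ubnP #|J|; elim: k J => // k IHk J ltJk.
have [->|[i iJ]] := set_0Vmem J.
  rewrite big_set0 /path_value set0D cards0 subr0 path_set0 /path_sum.
  apply/esym/big1 => -[p q] /consecutiveP[pD qD ltpq pqD].
  rewrite /Rset /= pD qD big1 // => i; rewrite inE => /andP[iD].
  by have := pqD (label i); rewrite mem_Dbar => /(_ iD) /= ->.
rewrite (big_setD1 i) //= IHk; last by rewrite (cardsD1 i J) iJ in ltJk.
move: (setD11 i J) => /negbT; set K := J :\ i => iNK; rewrite -(setD1K iJ) -/K.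
have := (path_set_add_if1 D true iNK, path_set_add_if1 D false iNK).
(* The paths of [K] and of [i |: K] are [W] with and without [label i], in an order that depends on
   whether [i] is in [D]. *)
set W := path_set D K :\ label i; rewrite /= => E.
have iNW : label i \notin W by rewrite setD11.
have [p [q [pqW pqi]]] : exists p q, (p, q) \in consecutive W /\ (p < label i < q)%N.
  by apply: consecutive_around_label => //; exact/has_endsD1/path_set_ends.
have [ltpi ltiq] := andP pqi; have ltpq := ltn_trans ltpi ltiq.
have jump : path_sum (fun d => \sum_(i in Rset D (~: D) d) w i) (label i |: W) =
    path_sum (fun d => \sum_(i in Rset D (~: D) d) w i) W +
    ((i \notin D)%:R * \sum_i w i + (if i \in D then -1 else 1) * w i).
  rewrite (path_sum_setU1 _ pqW pqi) !sum_Rset //; congr (_ + _).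
  rewrite mulr_sumr [w i](_ : _ = \sum_k (k == i)%:R * w k); last first.
    by rewrite (bigD1 i) //= eqxx mul1r big1 ?addr0 // => j /negbTE ->; rewrite mul0r.
  transitivity (\sum_k left_coeff (label i) k * w k +
                \sum_k right_coeff (label i) k * w k); first by ring.
  rewrite !mulr_sumr -!big_split; apply: eq_bigr => j _ /=.
  by rewrite -mulrDl left_right_coeff mulrDl mulrA.
rewrite /path_value !E card_setU1_diff // /add_if.
by move: jump; case: (i \in D) => /= ->; ring.
Qed.

End Weights.
End Labels.

(** * The tight values of the associahedron *)

Section ExtremalValue.
Variables (R : realFieldType) (n : nat) (D : {set 'I_n}).
Implicit Types (J K : {set 'I_n}) (p q x y : 'I_n.+2) (i j : 'I_n).

Notation Rd := (Rset D (~: D)).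

Definition half_pronic (k : nat) : R := (k * k.+1)%:R / 2.

(** The candidate for the minimum of the coordinate sum over J on the associahedron; [base_value_le]
    and [base_value_attained] confirm it. *)
Definition base_value J : R :=
  path_value D (fun d => half_pronic #|Rd d|) (half_pronic n) J.

Lemma half_pronicE k : half_pronic k = k%:R * (k%:R + 1) / 2.
Proof. by rewrite /half_pronic natrM -addn1 natrD. Qed.

Lemma card_Rset p q : (p < q)%N ->
  #|Rd (p, q)|%:R = \sum_i left_coeff R D p i + \sum_i right_coeff R D q i.
Proof.
move=> ltpq; have := sum_Rset D (fun=> 1 : R) ltpq; rewrite sumr_const => ->.
by congr (_ + _); apply: eq_bigr => i _; rewrite mulr1.
Qed.

Lemma base_value_supermodular J i j : i \notin J -> j \notin J -> i != j ->
  base_value (i |: J) + base_value (j |: J) <=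
  base_value (i |: (j |: J)) + base_value J.
Proof.
wlog ltij : i j / (i < j)%N => [wl iNJ jNJ neqij|].
  have : (i : nat) != j by []; case: ltngtP => // lt _; first exact: wl.
  by rewrite addrC setUCA wl // eq_sym.
move=> iNJ jNJ neqij.
suff : 0 <= base_value (i |: (j |: J)) - base_value (i |: J)
            - base_value (j |: J) + base_value J by lra.
rewrite /base_value path_value_diff2 //; set W := _ :\ _ :\ _.
have Wends : has_ends W by do 2 apply: has_endsD1; exact: path_set_ends.
have iNW : label i \notin W by rewrite !in_setD1 eqxx andbF.
have jNW : label j \notin W by rewrite !in_setD1 eqxx.
have ltl : (label i < label j)%N by [].
have [p [q [pqW /andP[ltpi ltiq]]]] := consecutive_around_label Wends iNW.
have [pW qW ltpq Wpq] := consecutiveP _ _ _ pqW.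
have [ltqj|ltjq|qj] := ltngtP q (label j); last first.
- by rewrite -(val_inj qj) qW in jNW.
- rewrite (path_diff2_consecutive _ pqW) // !half_pronicE.
  rewrite !card_Rset //; do ?by [|exact: ltn_trans ltjq|exact: ltn_trans ltl].
  set Ai := \sum_k left_coeff R D (label i) k; set Ap := \sum_k left_coeff R D p k.
  set Bj := \sum_k right_coeff R D (label j) k; set Bq := \sum_k right_coeff R D q k.
  (* The linear part of h cancels and the squares leave only the cross terms. A factor is
     nonpositive for an element of D, and the power of -1 in front compensates for this. *)
  rewrite [X in _ * X](_ : _ = (Ai - Ap) * (Bj - Bq)); last by field.
  rewrite exprD.
  have [iD|iND] := boolP (i \in D); have [jD|jND] := boolP (j \in D);
    rewrite ?(expr0, expr1, mulrNN, mulr1, mul1r, mulN1r).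
  + rewrite mulr_le0 // subr_le0; apply: ler_sum => k _.
      exact: left_coeff_le.
    exact: right_coeff_le.
  + rewrite oppr_ge0 mulr_le0_ge0 // ?subr_le0 ?subr_ge0; apply: ler_sum => k _.
      exact: left_coeff_le.
    exact: right_coeff_ge.
  + rewrite oppr_ge0 mulr_ge0_le0 // ?subr_le0 ?subr_ge0; apply: ler_sum => k _.
      exact: left_coeff_ge.
    exact: right_coeff_le.
  + rewrite mulr_ge0 // subr_ge0; apply: ler_sum => k _.
      exact: left_coeff_ge.
    exact: right_coeff_ge.
have [W0 Wm] := andP Wends.
rewrite (path_diff2_separated _ W0 Wm qW) ?mulr0 ?label_lt_max //.
by rewrite ltiq ltqj.
Qed.

(* h(k) = k(n+1)/2 + k(k-n)/2, where the linear part contributes |J|(n+1)/2 and the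
   rest vanishes on the empty set and on [n]. *)
Lemma base_value_eq J : base_value J =
  #|J|%:R * (n%:R + 1) / 2 +
  \sum_(d in consecutive (path_set D J)) (#|Rd d|%:R * (#|Rd d|%:R - n%:R)) / 2.
Proof.
rewrite [_ * _ / 2](_ : _ = \sum_(i in J) (n%:R + 1) / 2); last first.
  by rewrite sumr_const -[RHS]mulr_natl mulrA.
rewrite (sum_path_value D) /base_value /path_value addrAC /path_sum -big_split /=.
congr (_ - _ *+ _); last by rewrite half_pronicE sumr_const card_ord -[RHS]mulr_natl mulrA.
by apply: eq_bigr => d _; rewrite half_pronicE sumr_const -[_ / 2 *+ _]mulr_natl; field.
Qed.

Lemma Rset_between_Dbar p q : p \in Dbar D -> q \in Dbar D ->
  (forall w, w \in Dbar D -> (p < w < q)%N = false) -> Rd (p, q) = set0.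
Proof.
move=> pD qD pqD; rewrite /Rset /= pD qD; apply/setP=> i; rewrite !inE.
by have [iD|//] := boolP (i \in D); have := pqD (label i); rewrite mem_Dbar => /(_ iD).
Qed.

(** The hypotheses make p and q consecutive in U with 0 and n+1 adjoined, so that {p, q} is an edge
    or diagonal with all of D and U on the side counted by R_{p,q}. *)
Lemma Rset_between_compl p q : (p < q)%N ->
  (p == ord0) || (p \notin Dbar D) -> (q == ord_max) || (q \notin Dbar D) ->
  (forall i, i \notin D -> (p < label i < q)%N = false) -> Rd (p, q) = setT.
Proof.
move=> ltpq pU qU pqU; apply/setP=> i; rewrite in_setT /Rset /=.
have p0 : p \in Dbar D -> p = 0%N :> nat.
  by move=> pD; move: pU; rewrite pD orbF => /eqP ->.
have qm : q \in Dbar D -> q = n.+1 :> nat.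
  by move=> qD; move: qU; rewrite qD orbF => /eqP ->.
have := pqU i; have := ltn_ord i.
case: ifP p0 => [_ /(_ isT) p0|_ _]; case: ifP qm => [_ /(_ isT) qm|_ _];
  rewrite !inE; case: (i \in D) => //= ltin; do ?move=> /(_ isT); lia.
Qed.

(** Together with the next two lemmas this describes the path of R_{x,y}: from 0 to x through D or
    through U, according to where x lies, then directly from x to y, then through D or U to n+1. *)
Lemma path_set_Rset_left x y p : (x < y)%N -> (p <= x)%N ->
  (p \in path_set D (Rd (x, y))) =
  if x \in Dbar D then p \in Dbar D else (p == ord0) || (p \notin Dbar D).
Proof.
move=> ltxy lepx; case: (labelP p) => [p0|pm|i pi].
- by rewrite p0 path_set_ord0 ord0_Dbar eqxx; case: ifP.
- by have := ltn_ord y; move: lepx; rewrite pm /=; lia.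
move: lepx; rewrite pi path_set_label label_neq0 mem_Dbar /Rset /=.
case: ifP => xD; case: ifP => yD; rewrite !inE; case: (i \in D) => //=; lia.
Qed.

Lemma path_set_Rset_right x y p : (x < y)%N -> (y <= p)%N ->
  (p \in path_set D (Rd (x, y))) =
  if y \in Dbar D then p \in Dbar D else (p == ord_max) || (p \notin Dbar D).
Proof.
move=> ltxy leyp; case: (labelP p) => [p0|pm|i pi].
- by move: leyp; rewrite p0 /=; lia.
- by rewrite pm path_set_ord_max ord_max_Dbar eqxx; case: ifP.
move: leyp; rewrite pi path_set_label label_neq_max mem_Dbar /Rset /=.
case: ifP => xD; case: ifP => yD; rewrite !inE; case: (i \in D) => //=; lia.
Qed.

Lemma path_set_Rset_between x y p : (x < p < y)%N ->
  p \notin path_set D (Rd (x, y)).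
Proof.
move=> /andP[ltxp ltpy]; case: (labelP p) => [p0|pm|i pi].
- by move: ltxp; rewrite p0.
- by have := ltn_ord y; move: ltpy; rewrite pm /=; lia.
move: ltxp ltpy; rewrite pi path_set_label /Rset /=.
case: ifP => xD; case: ifP => yD; rewrite !inE; case: (i \in D) => //=; lia.
Qed.

Lemma consecutive_Rset x y : (x < y)%N ->
  (x, y) \in consecutive (path_set D (Rd (x, y))).
Proof.
move=> ltxy; apply/consecutiveP; split=> //.
- by rewrite path_set_Rset_left //; case: ifP => // ->; rewrite orbT.
- by rewrite path_set_Rset_right //; case: ifP => // ->; rewrite orbT.
by move=> w wW; apply: contraTF wW; exact: path_set_Rset_between.
Qed.

(** All other steps of the path follow the chain of D, where R is empty, or that of U, where R is
    [n]. Since k(k-n) vanishes for k = 0 and k = n, only (x, y) contributes to [base_value_eq]. *)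
Lemma consecutive_Rset_trivial x y p q : (x < y)%N ->
  (p, q) \in consecutive (path_set D (Rd (x, y))) -> (p, q) != (x, y) ->
  Rd (p, q) = set0 \/ Rd (p, q) = setT.
Proof.
move=> ltxy pqW neq; have [pW qW ltpq Wpq] := consecutiveP _ _ _ pqW.
have [leqx|ltxq] := leqP q x.
  have lepx := leq_trans (ltnW ltpq) leqx.
  have WE w : (p < w < q)%N -> (w <= x)%N by lia.
  move: pW qW; rewrite !path_set_Rset_left //; case: ifP => xD pD qD.
    left; apply: Rset_between_Dbar => // w wD; apply/negP => pwq.
    by have := Wpq w; rewrite path_set_Rset_left ?WE // xD wD pwq => /(_ isT).
  right; apply: Rset_between_compl => //.
    case/orP: qD => [/eqP q0|->]; last by rewrite orbT.
    by move: ltpq; rewrite q0.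
  move=> i iND; apply/negP => pwq.
  by have := Wpq (label i); rewrite path_set_Rset_left ?WE // xD mem_Dbar iND orbT pwq => /(_ isT).
have [leyp|ltpy] := leqP y p.
  have leyq := leq_trans leyp (ltnW ltpq).
  have WE w : (p < w < q)%N -> (y <= w)%N by lia.
  move: pW qW; rewrite !path_set_Rset_right //; case: ifP => yD pD qD.
    left; apply: Rset_between_Dbar => // w wD; apply/negP => pwq.
    by have := Wpq w; rewrite path_set_Rset_right ?WE // yD wD pwq => /(_ isT).
  right; apply: Rset_between_compl => //.
    case/orP: pD => [/eqP pm|->]; last by rewrite orbT.
    by have := ltn_ord q; move: ltpq; rewrite pm /=; lia.
  move=> i iND; apply/negP => pwq.
  by have := Wpq (label i); rewrite path_set_Rset_right ?WE // yD mem_Dbar iND orbT pwq => /(_ isT).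
by rewrite (consecutive_overlap pqW (consecutive_Rset ltxy)) ?eqxx in neq.
Qed.

Lemma base_value_Rset x y : (x < y)%N ->
  base_value (Rd (x, y)) = half_pronic #|Rd (x, y)|.
Proof.
move=> ltxy; rewrite base_value_eq half_pronicE.
rewrite (big_setD1 (x, y)) ?consecutive_Rset //= big1 ?addr0; first by field.
move=> [p q]; rewrite in_setD1 => /andP[neq /(consecutive_Rset_trivial ltxy)].
by case=> // ->; rewrite ?cards0 ?cardsT ?card_ord ?subrr ?mulr0 !mul0r.
Qed.

Lemma base_value_setT : base_value setT = half_pronic n.
Proof.
rewrite base_value_eq half_pronicE cardsT card_ord big1 ?addr0 // => -[p q].
case/consecutiveP=> pW qW ltpq Wpq; rewrite Rset_between_compl //.
- by rewrite cardsT card_ord subrr mulr0 mul0r.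
- case: (labelP p) pW => [->|pm|i ->]; rewrite ?eqxx ?path_set_label ?in_setT ?addbT.
  + by [].
  + by have := ltn_ord q; move: ltpq; rewrite pm /=; lia.
  + by rewrite mem_Dbar => ->; rewrite orbT.
- case: (labelP q) qW => [q0|->|i ->]; rewrite ?eqxx ?path_set_label ?in_setT ?addbT.
  + by move: ltpq; rewrite q0.
  + by [].
  + by rewrite mem_Dbar => ->; rewrite orbT.
by move=> i iND; apply: Wpq; rewrite path_set_label in_setT addbT.
Qed.

Lemma base_value0 : base_value set0 = 0.
Proof.
rewrite base_value_eq cards0 !mul0r add0r path_set0 big1 // => -[p q].
case/consecutiveP=> pD qD ltpq pqD.
by rewrite Rset_between_Dbar // cards0 !mul0r.
Qed.

End ExtremalValue.

(** * From sorted enumerations to consecutive pairs *)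

Section SortedConsecutive.
Variable m : nat.
Implicit Types (s : seq 'I_m) (A : {set 'I_m}).

Let lt_ord : rel 'I_m := fun i j => (i < j)%N.

Let lt_ord_trans : transitive lt_ord.
Proof. by move=> j i k; exact: ltn_trans. Qed.

Lemma sorted_enum_set A : sorted lt_ord (enum A).
Proof.
rewrite (_ : enum A = [seq x <- enum 'I_m | x \in A]); last by rewrite enumT.
apply: sorted_filter; first exact: lt_ord_trans.
have := iota_ltn_sorted 0 m; rewrite -val_enum_ord sorted_map.
by apply: sub_sorted.
Qed.

Lemma sorted_consecutive s : sorted lt_ord s ->
  sorted (fun x y => (x, y) \in consecutive [set z in s]) s.
Proof.
case: s => // x0 s lt_s; apply/(sortedP x0) => k ltk; set t := x0 :: s in lt_s ltk *.
have lt_nth k1 k2 : (k1 < size t)%N -> (k2 < size t)%N -> (k1 < k2)%N ->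
    (nth x0 t k1 < nth x0 t k2)%N.
  by move=> lt1 lt2; apply: (sorted_ltn_nth lt_ord_trans x0 lt_s).
apply/consecutiveP; split.
- by rewrite inE mem_nth // ltnW.
- by rewrite inE mem_nth.
- by apply: lt_nth; rewrite // ltnW.
move=> w; rewrite inE => /(nthP x0)[l ltl <-]; apply/negP => /andP[ltkl ltlk].
have [lelk|ltkl'] := leqP l k.
  move: lelk; rewrite leq_eqVlt => /orP[/eqP lk|ltlk'].
    by rewrite lk ltnn in ltkl.
  by have := ltn_trans ltkl (lt_nth l k ltl (ltnW ltk) ltlk'); rewrite ltnn.
move: ltkl'; rewrite leq_eqVlt => /orP[/eqP lk|ltlk'].
  by rewrite -lk ltnn in ltlk.
by have := ltn_trans ltlk (lt_nth k.+1 l ltk ltl ltlk'); rewrite ltnn.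
Qed.

Lemma sorted_zip_behead (T : eqType) (e : rel T) (s : seq T) d :
  sorted e s -> d \in zip s (behead s) -> e d.1 d.2.
Proof.
case: s => //= x s; elim: s x => //= y s IHs x /andP[exy path_s].
by rewrite in_cons => /orP[/eqP -> //|]; exact: IHs.
Qed.

Lemma zip_enum_consecutive A d :
  d \in zip (enum A) (behead (enum A)) -> d \in consecutive A.
Proof.
case: d => x y /(sorted_zip_behead (sorted_consecutive (sorted_enum_set A))) /=.
by rewrite (_ : [set z in enum A] = A) //; apply/setP=> z; rewrite inE mem_enum.
Qed.

Lemma head_enum_set A x0 x : x \in A ->
  head x0 (enum A) \in A /\ forall y, y \in A -> (head x0 (enum A) <= y)%N.
Proof.
have := sorted_enum_set A; have := mem_enum A; case: (enum A) => [|z s] memA.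
  by rewrite -memA.
rewrite /= (path_sortedE lt_ord_trans) => /andP[/allP zmin _] _.
split=> [|y]; rewrite -memA ?mem_head // in_cons => /orP[/eqP -> //|/zmin].
exact: ltnW.
Qed.

Lemma last_enum_set A x0 x : x \in A ->
  last x0 (enum A) \in A /\ forall y, y \in A -> (y <= last x0 (enum A))%N.
Proof.
have := sorted_enum_set A; have := mem_enum A; case/lastP: (enum A) => [|s z] memA.
  by rewrite -memA.
rewrite (sorted_pairwise lt_ord_trans) pairwise_rcons => /andP[/allP zmax _] _.
rewrite last_rcons; split=> [|y]; rewrite -memA mem_rcons ?mem_head //.
by rewrite in_cons => /orP[/eqP -> //|/zmax]; exact: ltnW.
Qed.

End SortedConsecutive.

(** * Polygon boundary and nested components *)

Section Combinatorics.
Variables (n : nat) (D : {set 'I_n}).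
Implicit Types (I J : {set 'I_n}) (p q x y : 'I_n.+2) (i j : 'I_n).

Lemma sorted_Dbar (A : {set 'I_n}) : sorted
  (fun x y => (x, y) \in consecutive (Dbar A)) (ord0 :: rcons (enum (labels A)) ord_max).
Proof.
rewrite [Dbar A](_ : _ = [set z in ord0 :: rcons (enum (labels A)) ord_max]); last first.
  apply/setP=> z; rewrite in_setU in_set2 [RHS]inE in_cons mem_rcons in_cons mem_enum.
  by case: (z \in labels A); rewrite ?orbT ?orbF.
apply: sorted_consecutive; have lt_trans : transitive (fun i j : 'I_n.+2 => i < j)%N.
  by move=> j i k; exact: ltn_trans.
have := sorted_enum_set (labels A); rewrite !(sorted_pairwise lt_trans) /=.
rewrite pairwise_rcons all_rcons => ->; rewrite /= andbT; apply/andP; split;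
  by apply/allP => _ /[!mem_enum] /imsetP[i _ ->]; rewrite ?label_gt0 ?label_lt_max.
Qed.

(** The boundary ascends through D and descends through U, whence the swapped pair. *)
Definition boundary_step x y :=
  ((x, y) \in consecutive (Dbar D)) || ((y, x) \in consecutive (Dbar (~: D))).

Lemma boundary_cycle : cycle boundary_step (boundary D (~: D)).
Proof.
rewrite /boundary /cycle rcons_cat rcons_cons -cat_rcons cat_path last_rcons.
apply/andP; split.
  have := sorted_Dbar D; rewrite /=; apply: sub_path => x y xy.
  by rewrite /boundary_step xy.
have := sorted_Dbar (~: D); rewrite -[X in sorted _ X]revK rev_sorted.
rewrite rev_cons rev_rcons /=; apply: sub_path => x y xy.
by rewrite /boundary_step xy orbT.
Qed.

(** The first alternative absorbs the default value of [next] outside the list. *)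
Lemma next_boundary x :
  next (boundary D (~: D)) x = x \/ boundary_step x (next (boundary D (~: D)) x).
Proof.
have [xb|xNb] := boolP (x \in boundary D (~: D)).
  by right; apply: next_cycle => //; exact: boundary_cycle.
by left; rewrite next_nth ifN.
Qed.

(** The associahedron bounds proper diagonals only; this lets the bound be extended to every pair p
    < q. *)
Lemma Rset_adjacent p q : (p < q)%N -> adjacent D (~: D) p q ->
  Rset D (~: D) (p, q) = set0 \/ Rset D (~: D) (p, q) = setT.
Proof.
move=> ltpq adj; have {adj} [pqD|pqU] : (p, q) \in consecutive (Dbar D) \/
    (p, q) \in consecutive (Dbar (~: D)).
  case/orP: adj => /eqP adj.
  - have := next_boundary p; rewrite adj => -[qp|]; first by rewrite qp ltnn in ltpq.
    case/orP => [|/consecutiveP[_ _ ltqp]]; first by left.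
    by have := ltn_trans ltpq ltqp; rewrite ltnn.
  - have := next_boundary q; rewrite adj => -[qp|]; first by rewrite qp ltnn in ltpq.
    case/orP => [/consecutiveP[_ _ ltqp]|]; last by right.
    by have := ltn_trans ltpq ltqp; rewrite ltnn.
- by have [pD qD _ ?] := consecutiveP _ _ _ pqD; left; exact: Rset_between_Dbar.
have [pU qU _ pqU'] := consecutiveP _ _ _ pqU; right; apply: Rset_between_compl => //.
- case: (labelP p) pU => [->|pm|i ->]; last by rewrite !mem_Dbar in_setC orbC => ->.
    by rewrite eqxx.
  by have := ltn_ord q; move: ltpq; rewrite pm /=; lia.
- case: (labelP q) qU => [q0|->|i ->]; last by rewrite !mem_Dbar in_setC orbC => ->.
    by move: ltpq; rewrite q0.
  by rewrite eqxx.
by move=> i iND; apply: pqU'; rewrite mem_Dbar in_setC.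
Qed.

Lemma gaps_consecutive I d : d \in gaps D I -> d \in consecutive (Dbar D :\: labels I).
Proof. exact: zip_enum_consecutive. Qed.

Lemma min_labelP I : I != set0 ->
  exists i, [/\ i \in I, min_label I = label i & forall k, k \in I -> (i <= k)%N].
Proof.
case/set0Pn => k0 k0I; have k0L : label k0 \in labels I by rewrite mem_labels.
have [/imsetP[i iI minE] min_le] := head_enum_set ord0 k0L.
exists i; split=> // k kI; rewrite -mem_labels in kI.
by have := min_le _ kI; rewrite minE.
Qed.

Lemma max_labelP I : I != set0 ->
  exists i, [/\ i \in I, max_label I = label i & forall k, k \in I -> (k <= i)%N].
Proof.
case/set0Pn => k0 k0I; have k0L : label k0 \in labels I by rewrite mem_labels.
have [/imsetP[i iI maxE] le_max] := last_enum_set ord0 k0L.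
exists i; split=> // k kI; rewrite -mem_labels in kI.
by have := le_max _ kI; rewrite maxE.
Qed.

Section Extremes.
Variables (I : {set 'I_n}) (g G : 'I_n).
Hypotheses (gI : g \in I) (GI : G \in I).
Hypotheses (g_min : forall k, k \in I -> (g <= k)%N) (G_max : forall k, k \in I -> (k <= G)%N).

Definition inner_D : {set 'I_n} := [set i in D | (g < i < G)%N].

(** An element of D \ I between min I and max I separates them; without one, the gap that contains
    min I extends beyond max I. *)
Lemma one_nested_component :
  (#|nested_components D I| == 1%N) = (inner_D \subset I).
Proof.
apply/eqP/fintype.subsetP => [/enclosing_gapP[]|inner_sub].
  case: (enclosing_gap D I) => a b din Id i; rewrite inE => /andP[iD /andP[ltgi ltiG]]; apply/negPn/negP => iNI.
  have [_ _ _ between] := consecutiveP _ _ _ (gaps_consecutive din).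
  have := between (label i); rewrite in_setD mem_labels mem_Dbar iNI iD => /(_ isT).
  have := fintype.subsetP Id g gI; have := fintype.subsetP Id G GI; rewrite !inE /=.
  by lia.
have [[a b] abin gab] := gap_cover D gI.
have [aDI bDI ltab between] := consecutiveP _ _ _ (gaps_consecutive abin).
have Iab : I \subset open_interval (a, b).
  apply/fintype.subsetP => i iI; have ltgi := g_min iI.
  move: gab; rewrite !inE /= => /andP[ltag ltgb]; apply/andP; split; first by lia.
  (* Otherwise b would be the label of an element of D \ I strictly between [g] and [G]. *)
  rewrite ltnNge; apply/negP => lebi.
  case: (labelP b) => [bE|bE|k bE]; first by move: ltgb; rewrite bE.
    by have := ltn_ord i; move: lebi; rewrite bE /=; lia.
  move: bDI ltgb lebi; rewrite bE in_setD mem_labels mem_Dbar /= => /andP[kNI kD] ltgk leki.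
  have neqkG : (k : nat) != G by apply: contra kNI => /eqP /val_inj ->.
  have := inner_sub k; rewrite inE kD (negbTE kNI) => /implyP.
  by have := G_max iI; lia.
suff -> : nested_components D I = [set I] by rewrite cards1.
apply/setP => C; rewrite in_setD1 in_set1.
have IE : I :&: open_interval (a, b) = I by apply/setIidPl.
apply/andP/eqP => [[Cn0 /imsetP[[a' b'] ab'in CE]]|->]; last first.
  by split; [apply/set0Pn; exists g | apply/imsetP; exists (a, b)].
rewrite CE in Cn0 *; have [i] := set0Pn _ Cn0.
rewrite in_setI => /andP[iI iab']; have iab := fintype.subsetP Iab i iI.
move: iab iab'; rewrite !inE /= => /andP[ltai ltib] /andP[ltai' ltib'].
rewrite (consecutive_overlap (gaps_consecutive ab'in) (gaps_consecutive abin)) //.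
  exact: ltn_trans ltib.
exact: ltn_trans ltib'.
Qed.

End Extremes.

End Combinatorics.

(** * Transfer of the path formula from the associahedron to P *)

Section Tightness.
Variables (R : realType) (n : nat) (D : {set 'I_n}).
Implicit Types (J K : {set 'I_n}) (p q : 'I_n.+2) (x y : 'rV[R]_n) (P : set 'rV[R]_n).

Notation Rd := (Rset D (~: D)).
Notation As := (@associahedron R n D (~: D)).

Lemma sum_on_path J x : sum_on J x =
  path_value D (fun d => sum_on (Rd d) x) (sum_on setT x) J.
Proof.
rewrite /sum_on (sum_path_value D); congr path_value.
by apply: eq_bigl => i; rewrite in_setT.
Qed.

Lemma associahedron_Rset_ge x p q : As x -> (p < q)%N ->
  half_pronic R #|Rd (p, q)| <= sum_on (Rd (p, q)) x.
Proof.
move=> [xT xR] ltpq; have [prop|] := boolP (proper_diagonal D (~: D) (p, q)).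
  exact: xR.
rewrite negb_and negbK ltpq /= => /(Rset_adjacent ltpq)[->|->].
  by rewrite cards0 /sum_on big_set0 /half_pronic mul0n mul0r.
by rewrite cardsT card_ord xT.
Qed.

(** The path formula is exact for the coordinate sums of x, so the bounds can be compared term by
    term; the corrections agree since x has total h(n). *)
Lemma base_value_le x J : As x -> base_value R D J <= sum_on J x.
Proof.
move=> xAs; rewrite sum_on_path (proj1 xAs) lerD2r.
apply: ler_sum => -[p q] /consecutiveP[_ _ ltpq _].
exact: associahedron_Rset_ge.
Qed.

(** The greedy point lies in the associahedron because [base_value] equals h(|R|) on each of the
    sets R and h(n) on [n]. *)
Lemma base_value_attained J : exists2 x, As x & sum_on J x = base_value R D J.
Proof.
have [y [yJ yT yK]] := supermodular_base (base_value0 R D)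
  (@base_value_supermodular R n D) J.
have sumE K : sum_on K (\row_i y i) = \sum_(i in K) y i.
  by apply: eq_bigr => i _; rewrite mxE.
exists (\row_i y i); last by rewrite sumE.
split=> [|[p q] /andP[/= ltpq _]].
  rewrite sumE -[RHS](base_value_setT R D) -yT.
  by apply: eq_bigl => i; rewrite in_setT.
by rewrite sumE; have := yK (Rd (p, q)); rewrite base_value_Rset.
Qed.

(** Nonnegative slacks with sum zero all vanish. *)
Lemma base_value_tight J x d : As x -> sum_on J x = base_value R D J ->
  d \in consecutive (path_set D J) -> sum_on (Rd d) x = half_pronic R #|Rd d|.
Proof.
move=> xAs; rewrite sum_on_path (proj1 xAs) => /addIr sumE dW; apply/eqP; move: d dW.
have ge d : d \in consecutive (path_set D J) ->
    half_pronic R #|Rd d| <= sum_on (Rd d) x.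
  case: d => p q /consecutiveP[_ _ ltpq _]; exact: associahedron_Rset_ge.
have : \sum_(d in consecutive (path_set D J)) (sum_on (Rd d) x - half_pronic R #|Rd d|) = 0.
  by rewrite sumrB; apply/eqP; rewrite subr_eq0; apply/eqP.
move/eqP; rewrite psumr_eq0 => [/allP all0 d dW|d dW]; last by rewrite subr_ge0 ge.
by have := all0 d; rewrite mem_index_enum dW subr_eq0 => /(_ isT).
Qed.

(** Faces maximize [dot], while tight right-hand sides are minima; hence the sign. *)
Definition descent K : 'rV[R]_n := \row_i - (i \in K)%:R.

Lemma dot_descent K x : dot (descent K) x = - sum_on K x.
Proof.
rewrite /dot /sum_on [in RHS]big_mkcond /= -sumrN; apply: eq_bigr => i _.
by rewrite mxE; case: ifP => _; rewrite ?mulN1r ?oppr0 ?mul0r.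
Qed.

Lemma tight_rhs_normal_cone P (F : set 'rV[R]_n) w K : polytope P -> P w -> F w ->
  normal_cone P F (descent K) -> tight_rhs P K = sum_on K w.
Proof.
move=> polyP Pw Fw cK; have [[x Px xK] wK] := tight_rhsP K polyP.
apply/eqP; rewrite eq_le wK //= xK.
by have := cK w x Fw Px; rewrite !dot_descent lerN2.
Qed.

Lemma tight_rhs_path P J : polytope P -> normal_fan P = normal_fan As ->
  tight_rhs P J = path_value D (fun d => tight_rhs P (Rd d)) (tight_rhs P setT) J.
Proof.
move=> polyP fanE; have [x0 x0As x0J] := base_value_attained J.
pose F := face As (descent J).
have Fx0 : F x0.
  split=> // y yAs; rewrite !dot_descent lerN2 x0J; exact: base_value_le.
have FJ x : F x -> As x /\ sum_on J x = base_value R D J.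
  move=> [xAs xmax]; split=> //; apply/eqP; rewrite eq_le base_value_le // andbT -x0J.
  by have := xmax _ x0As; rewrite !dot_descent lerN2.
have : normal_fan As (normal_cone As F).
  by exists F => //; split; [exists x0 | exists (descent J)].
(* The cone of [F] is also the cone of a face of [P]. Any point [w] of that face minimizes over [P]
   every coordinate sum that is minimal on [F] in the associahedron; this applies to J, to [n] and
   to each R along the path of J. *)
rewrite -fanE => -[F' [[w F'w] [c F'E]] coneE].
have Pw : P w by move: F'w; rewrite F'E => -[].
have tightE K : (forall x y, F x -> As y -> sum_on K x <= sum_on K y) ->
    tight_rhs P K = sum_on K w.
  move=> Kmin; apply: (tight_rhs_normal_cone polyP Pw F'w); rewrite coneE.
  by move=> x y Fx yAs; rewrite !dot_descent lerN2; exact: Kmin.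
rewrite (tightE J); last first.
  by move=> x y /FJ[_ ->] yAs; exact: base_value_le.
rewrite (tightE setT); last first.
  by move=> x y /FJ[[-> _] _] [-> _].
rewrite sum_on_path; congr (_ - _); apply: eq_bigr => -[p q] pqW.
have [_ _ ltpq _] := consecutiveP _ _ _ pqW.
rewrite tightE // => x y /FJ[xAs xJ] yAs.
by rewrite (base_value_tight xAs xJ pqW) associahedron_Rset_ge.
Qed.

End Tightness.

(** * Alternating sums over subsets *)

Section Alternating.
Variables (T : finType) (R : comNzRingType) (f : {set T} -> R).
Implicit Types (I J : {set T}).

Lemma sum_subset_split I i : i \in I ->
  \sum_(J : {set T} | J \subset I) f J =
  \sum_(J : {set T} | J \subset I :\ i) (f (i |: J) + f J).
Proof.
move=> iI; rewrite (bigID (fun J : {set T} => i \in J)) /= big_split /=.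
congr (_ + _); last by apply: eq_bigl => J; rewrite subsetD1.
rewrite (reindex_onto (fun J : {set T} => i |: J) (fun J => J :\ i)) /=; last first.
  by move=> J /andP[_ iJ]; rewrite setD1K.
apply: eq_bigl => J; rewrite setU11 andbT subUset sub1set iI subsetD1 /=.
case: (J \subset I) => //=; apply/eqP/idP => [<-|iNJ]; first by rewrite setD11.
by rewrite setU1K.
Qed.

Definition alternating_sum I := \sum_(J : {set T} | J \subset I) (-1) ^+ #|I :\: J| * f J.

End Alternating.

(** J and [i |: J] carry opposite signs. Applied at min I and then at max I, this produces mixed
    second differences. *)
Lemma alternating_sumD1 (T : finType) (R : comNzRingType) (f : {set T} -> R)
    (I : {set T}) i : i \in I ->
  alternating_sum f I = alternating_sum (fun J => f (i |: J) - f J) (I :\ i).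
Proof.
move=> iI; rewrite /alternating_sum (sum_subset_split _ iI); apply: eq_bigr => J.
rewrite subsetD1 => /andP[_ iNJ].
have -> : I :\: (i |: J) = (I :\ i) :\: J by rewrite setDDl.
have -> : I :\: J = i |: ((I :\ i) :\: J).
  apply/setP=> k; rewrite !inE; have [->|_] := eqVneq k i; last by [].
  by rewrite iI iNJ.
by rewrite cardsU1 !inE eqxx andbF exprS; ring.
Qed.

(** * Minkowski coefficients of a path formula *)

Section PathCoefficient.
Variables (R : comNzRingType) (n : nat) (D : {set 'I_n}).
Variables (G : 'I_n.+2 * 'I_n.+2 -> R) (c : R).
Variables (I : {set 'I_n}) (g h : 'I_n).
Hypotheses (gI : g \in I) (hI : h \in I).
Hypotheses (g_min : forall k, k \in I -> (g <= k)%N) (h_max : forall k, k \in I -> (k <= h)%N).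

Notation y := (alternating_sum (path_value D G c) I).

Let K := I :\ g :\ h.

Let K_between k : k \in K -> (g < k < h)%N.
Proof.
rewrite !in_setD1 => /and3P[neqkh neqkg kI].
have := g_min kI; have := h_max kI.
have : (k : nat) != g by []. have : (k : nat) != h by [].
by lia.
Qed.

Let between_K k : k \in I -> (g < k < h)%N -> k \in K.
Proof.
move=> kI gkh; rewrite !in_setD1 kI andbT.
by apply/andP; split; apply: contraTneq gkh => ->; rewrite ltnn ?andbF.
Qed.

Let y_diff2 : g != h -> y =
  \sum_(J : {set 'I_n} | J \subset K) (-1) ^+ #|K :\: J| * ((-1) ^+ ((g \in D) + (h \in D)) *
    path_diff2 G (path_set D J :\ label g :\ label h) (label g) (label h)).
Proof.
move=> neqgh; rewrite (alternating_sumD1 _ gI) (@alternating_sumD1 _ _ _ _ h); last first.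
  by rewrite in_setD1 eq_sym neqgh.
apply: eq_bigr => J JK; congr (_ * _).
have gNJ : g \notin J.
  by apply/negP => /(fintype.subsetP JK) /K_between; rewrite ltnn.
have hNJ : h \notin J.
  by apply/negP => /(fintype.subsetP JK) /K_between; rewrite ltnn andbF.
by rewrite -(path_value_diff2 D G c) //; ring.
Qed.

(* The only J contributing to y_I is inner_D D g h: otherwise some vertex of the
   path of J separates g from h. *)
Let path_diff2_inner_D (J : {set 'I_n}) : J \subset K -> J != inner_D D g h ->
  path_diff2 G (path_set D J :\ label g :\ label h) (label g) (label h) = 0.
Proof.
move=> JK neqJ; have ends := has_endsD1 h (has_endsD1 g (path_set_ends D J)).
have [k gkh kDJ] : exists2 k : 'I_n, (g < k < h)%N & (k \in D) (+) (k \in J).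
  apply/exists_inP; apply: contraR neqJ; rewrite negb_exists_in => /forall_inP allk.
  apply/eqP/setP => k; rewrite inE.
  have := allk k; have [gkh /(_ isT)|gkh _] := boolP (g < k < h)%N.
    by rewrite andbT; case: (k \in D); case: (k \in J).
  rewrite andbF; apply/negP => /(fintype.subsetP JK) /K_between gkh'.
  by rewrite gkh' in gkh.
have [W0 Wm] := andP ends.
apply: (path_diff2_separated _ W0 Wm (w := label k)) => //.
- rewrite !in_setD1 path_set_label kDJ !(inj_eq (@label_inj n)) andbT.
  by apply/andP; split; apply: contraTneq gkh => ->; rewrite ltnn ?andbF.
- by rewrite !in_setD1 eqxx andbF.
- by rewrite !in_setD1 eqxx.
- by rewrite label_lt_max.
Qed.

(** The only subset that could contribute is not contained in I. For g = h it would be empty, so g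
    and h are distinct here. *)
Lemma path_coefficient0 : ~~ (inner_D D g h \subset I) -> y = 0.
Proof.
move=> innerNI.
have neqgh : g != h.
  apply: contraNneq innerNI => ->; apply/fintype.subsetP => k.
  by rewrite inE => /andP[_]; lia.
have KI : K \subset I by apply/fintype.subsetP => k; rewrite !in_setD1 => /and3P[].
rewrite y_diff2 // big1 // => J JK.
have neqJ : J != inner_D D g h.
  by apply: contraNneq innerNI => <-; exact: fintype.subset_trans JK KI.
by rewrite (path_diff2_inner_D JK neqJ) !mulr0.
Qed.

Variables a b : 'I_n.+2.
Hypotheses (ab_gap : (a, b) \in consecutive (Dbar D :\: labels I))
           (I_ab : I \subset open_interval (a, b)).

(** Since I lies in a single gap of [Dbar D] minus I, every element of D between g and h belongs to
    I. *)
Let inner_DE k : (k \in inner_D D g h) = (k \in D) && (k \in K).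
Proof.
have [_ _ _ between] := consecutiveP _ _ _ ab_gap.
rewrite inE; have [kD|//] := boolP (k \in D); apply/idP/idP => [gkh|/K_between //].
apply: between_K => //; apply/negPn/negP => kNI.
have := between (label k); rewrite in_setD mem_labels mem_Dbar kNI kD => /(_ isT).
have := fintype.subsetP I_ab g gI; have := fintype.subsetP I_ab h hI.
by rewrite !inE /=; lia.
Qed.

Lemma path_coefficient_distinct : g != h -> y = (-1) ^+ #|I :\: D| *
  (G (a, b) - G (a, label h) - G (label g, b) + G (label g, label h)).
Proof.
move=> neqgh; rewrite y_diff2 //.
have innerK : inner_D D g h \subset K.
  by apply/fintype.subsetP => k; rewrite inner_DE => /andP[].
rewrite (bigD1 (inner_D D g h)) //= big1 ?addr0; last first.
  by move=> J /andP[JK neqJ]; rewrite (path_diff2_inner_D JK neqJ) !mulr0.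
have [aDI bDI ltab between] := consecutiveP _ _ _ ab_gap.
have notI x : x \in Dbar D :\: labels I ->
    x \in path_set D (inner_D D g h) :\ label g :\ label h.
  rewrite in_setD => /andP[xNI xD].
  have neq i : i \in I -> x != label i.
    by move=> iI; apply: contraNneq xNI => ->; rewrite mem_labels.
  rewrite !in_setD1 !neq // [X in _ && X]inE xD /=; apply/imsetP => -[k kJ xk].
  move: kJ; rewrite inner_DE !in_setD1 => /and4P[_ _ _ kI].
  by have := neq k kI; rewrite xk eqxx.
(* Strictly between a and b, the path of [inner_D D g h] can only pass through g and h, so once
   these are removed a and b are the outer neighbours of both. *)
have ab_path : (a, b) \in consecutive (path_set D (inner_D D g h) :\ label g :\ label h).
  apply/consecutiveP; split; rewrite ?notI // => w.
  case: (labelP w) => [->|->|k ->].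
  - by rewrite ltnNge leq0n.
  - by rewrite [X in _ && X]ltnNge leq_ord andbF.
 
  rewrite !in_setD1 !(inj_eq (@label_inj n)) path_set_label inner_DE => /and3P[neqh neqg].
  rewrite (_ : (k \in K) = (k \in I)); last by rewrite !in_setD1 neqh neqg.
  have [kD|_] := boolP (k \in D); rewrite ?addbF // => kNI.
  by apply: (between (label k)); rewrite in_setD mem_labels mem_Dbar kD andbT.
have gab := fintype.subsetP I_ab g gI; have hab := fintype.subsetP I_ab h hI.
rewrite (path_diff2_consecutive _ ab_path); first last.
- by move: hab; rewrite inE => /andP[].
- have : (g : nat) != h by [].
  by rewrite /= ltnS ltn_neqAle g_min // => ->.
- by move: gab; rewrite inE => /andP[].
(* For the sign: membership of g and h in D enters the second difference, non-membership enters |I \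
   D|, and over the two elements these counts have the same parity. *)
have -> : #|I :\: D| = ((g \notin D) + ((h \notin D) + #|K :\: inner_D D g h|))%N.
  rewrite -{1}(setD1K gI) card_setU1_diff ?setD11 //.
  rewrite -(@setD1K _ h (I :\ g)) ?in_setD1 ?(eq_sym h) ?neqgh // card_setU1_diff ?setD11 //.
  congr (_ + (_ + #|pred_of_set _|))%N; apply/setP => k.
  by rewrite in_setD [in RHS]in_setD inner_DE; case: (k \in D); case: (k \in K).
rewrite !exprD; case: (g \in D); case: (h \in D);
  rewrite ?(expr0, expr1, mulrN1, mulN1r); ring.
Qed.

(** With min I = max I only a first difference is available. Its correction term takes the place of
    the fourth diagonal, the loop at g; [tight_rhs_loop] identifies the two. *)
Lemma path_coefficient_singleton : g = h -> y = (-1) ^+ #|I :\: D| *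
  (G (a, b) - G (a, label h) - G (label g, b) + (if g \in D then 0 else c)).
Proof.
move=> eqgh; have IE : I = [set g].
  apply/setP => k; rewrite in_set1; apply/idP/eqP => [kI|-> //].
  by apply: val_inj; have := g_min kI; have := h_max kI; rewrite -eqgh /=; lia.
rewrite (alternating_sumD1 _ gI) -eqgh.
have Ig0 : I :\ g = set0 by rewrite IE setDv.
rewrite Ig0 /alternating_sum (big_pred1 set0); last by move=> J; rewrite subset0.
rewrite setDv cards0 expr0 mul1r.
have ab_path : (a, b) \in consecutive (path_set D set0 :\ label g).
  by move: ab_gap; rewrite path_set0 IE /labels imset_set1.
have gab : (a < label g < b)%N by have := fintype.subsetP I_ab g gI; rewrite inE.
have gN0 : g \notin set0 by rewrite in_set0.
have := (path_set_add_if1 D true gN0, path_set_add_if1 D false gN0).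
move: (path_set D set0 :\ _) ab_path => W ab_path /= E.
rewrite -{1}(setD1K gI) Ig0 /path_value !card_setU1_diff // !E.
rewrite set0D cards0 /add_if; case: (g \in D) => /=;
  rewrite (path_sum_setU1 _ ab_path gab); ring.
Qed.

End PathCoefficient.

(** * Loop diagonals, the sign, and the conclusion *)

Section FourDiagonals.
Variables (R : realType) (n : nat) (D : {set 'I_n}) (P : set 'rV[R]_n).

Notation Rd := (Rset D (~: D)).

Lemma tight_rhs_loop i : polytope P ->
  tight_rhs P (Rd (label i, label i)) = if i \in D then 0 else tight_rhs P setT.
Proof.
move=> polyP; have [iD|iND] := boolP (i \in D).
  rewrite (_ : Rd _ = set0) ?tight_rhs0 //; apply/setP => k.
  by rewrite /Rset /= !mem_Dbar iD !inE; case: (k \in D) => //=; lia.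
congr tight_rhs; apply/setP => k.
by rewrite /Rset /= !mem_Dbar (negbTE iND) !inE; case: (k \in D) => //=; lia.
Qed.

(** Within (a, b) the set R_{a,b} coincides with D, which matches the exponent |I \ D| with that of
    the theorem. *)
Lemma Rset_gap a b (I : {set 'I_n}) : a \in Dbar D -> b \in Dbar D ->
  I \subset open_interval (a, b) -> I :\: Rd (a, b) = I :\: D.
Proof.
move=> aD bD /fintype.subsetP Iab; apply/setP => k; rewrite !in_setD /Rset /= aD bD.
have [kI|] := boolP (k \in I); rewrite ?andbF //.
by have := Iab k kI; rewrite !inE => ->; rewrite !andbT.
Qed.

End FourDiagonals.

Unset Implicit Arguments.

Theorem theorem4p2 (R : realType) (n : nat) (D U : {set 'I_n})
    (P : set 'rV[R]_n) (I : {set 'I_n}) :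
  (2 <= n)%N ->
  updown_partition D U ->
  polytope P ->
  normal_fan P = normal_fan (associahedron D U) ->
  I != set0 ->
  minkowski_coeff P I =
    if #|nested_components D I| == 1%N then
      (-1) ^+ #|I :\: Rset D U (delta1 D I)| *
        (tight_rhs P (Rset D U (delta1 D I))
         - tight_rhs P (Rset D U (delta2 D I))
         - tight_rhs P (Rset D U (delta3 D I))
         + tight_rhs P (Rset D U (delta4 I)))
    else 0.
Proof.
move=> _ [DU disjDU _ _] polyP fanE In0.
have UE : U = ~: D.
  apply/setP => k; rewrite in_setC.
  have : k \in D :|: U by rewrite DU in_setT.
  rewrite in_setU; have [kD|//] := boolP (k \in D).
  by move=> _; rewrite (disjointFr disjDU kD).
subst U.
have [g [gI gE g_min]] := min_labelP In0.
have [h [hI hE h_max]] := max_labelP In0.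
(* From here on only the path formula for z_J is used, with [G] and [c] given by the tight values of
   [P]. *)
have -> : minkowski_coeff P I = alternating_sum
    (path_value D (fun d => tight_rhs P (Rset D (~: D) d)) (tight_rhs P setT)) I.
  by apply: eq_bigr => J _; rewrite (tight_rhs_path J polyP fanE).
have compE := one_nested_component D gI hI g_min h_max.
case: ifPn => [comp1|]; last by rewrite compE; exact: path_coefficient0.
have [] := enclosing_gapP (eqP comp1).
rewrite /delta1 /delta2 /delta3 /delta4 gE hE.
case: (enclosing_gap D I) => a b /= /gaps_consecutive ab_gap Iab.
have [aDI bDI _ _] := consecutiveP _ _ _ ab_gap.
have [aD bD] : a \in Dbar D /\ b \in Dbar D.
  by move: aDI bDI; rewrite !in_setD => /andP[_ ->] /andP[_ ->].
rewrite Rset_gap //; have [eqgh|neqgh] := eqVneq g h; last first.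
  exact: path_coefficient_distinct.
rewrite (path_coefficient_singleton _ _ gI hI g_min h_max ab_gap Iab eqgh).
by rewrite -eqgh tight_rhs_loop.
Qed.
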